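(* Let $G$ be a finite power-chordal group. Then each non-singleton connected component of the Gruenberg-Kegel graph of $G$ contains a prime $p$ such that the following holds: $G$ contains an element $x$ with $|x|=p$ and $C_G(x)=Z\rtimes P$, where $Z$ is a cyclic $q$-group for a prime $q\neq p$ and $P$ is a $p$-group. Moreover, $C_P(Z)$ is either cyclic or of exponent $p$.
   Context: The power graph of a group $G$ is the simple graph with vertex set $G$ in which two distinct elements $x,y$ are joined by an edge if and only if $x^m=y$ or $y^m=x$ for some $m\in\mathbb{N}$. A graph is chordal if it has no induced cycle on at least four vertices. A group is power-chordal if its power graph is chordal. The Gruenberg-Kegel graph (prime graph) of a finite group $G$ has as vertices the primes dividing $|G|$, with distinct primes $p,q$ joined if and only if $G$ contains an element of order $pq$. *)

(* Defs.v *)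
From HB Require Import structures.
From mathcomp Require Import all_boot all_fingroup all_solvable.

Set Implicit Arguments.
Unset Strict Implicit.
Unset Printing Implicit Defensive.

Local Open Scope group_scope.

Definition power_adj (gT : finGroupType) (x y : gT) : Prop :=
  x <> y /\
  ((exists m : nat, x ^+ m = y) \/ (exists m : nat, y ^+ m = x)).

(* c enumerates the cycle in order; ordS is the successor modulo n. *)
Definition induced_cycle (T : finType) (V : {set T}) (e : T -> T -> Prop)
    (n : nat) (c : 'I_n -> T) : Prop :=
  [/\ injective c,
      forall i, c i \in V
    & forall i j, e (c i) (c j) <-> (j = ordS i \/ i = ordS j)].

Definition chordal (T : finType) (V : {set T}) (e : T -> T -> Prop) : Prop :=
  forall (n : nat) (c : 'I_n -> T), (4 <= n)%N -> ~ induced_cycle V e c.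

Definition power_chordal (gT : finGroupType) (G : {group gT}) : Prop :=
  chordal G (@power_adj gT).

Definition gk_vertex (gT : finGroupType) (G : {group gT}) : finType :=
  seq_sub (primes #|G|).

Definition gk_adj (gT : finGroupType) (G : {group gT}) : rel (gk_vertex G) :=
  fun p q => (p != q) && [exists x in G, #[x] == (ssval p * ssval q)%N].

Definition gk_components (gT : finGroupType) (G : {group gT}) :
    {set {set gk_vertex G}} :=
  [set [set q | connect (@gk_adj gT G) p q] | p : gk_vertex G].

(* Main.v *)
Require Import Defs.
From HB Require Import structures.
From mathcomp Require Import all_boot all_fingroup all_solvable.
From mathcomp Require Import integral_char zify.

Set Implicit Arguments.
Unset Strict Implicit.
Unset Printing Implicit Defensive.

Local Open Scope group_scope.

(** In a power graph, an induced cycle alternates between elements that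
    generate large cyclic groups (tops) and elements lying in two consecutive
    ones (bottoms), because being a power is transitive. Two consequences of
    chordality carry the whole proof. First, two cyclic subgroups whose
    intersection contains incomparable elements are comparable
    ([cyclic_meet_comparable], a missing 4-cycle). Second, the graph on the
    subgroups of prime order of G, in which two subgroups of distinct orders
    are linked when they commute, is a forest ([linked_acyclic]): a cycle
    A_1, ..., A_k there lifts to the induced 2k-cycle with bottoms generating
    the A_i and tops generating the products A_i A_(i+1). Links of this forest
    induce the edges of the Gruenberg-Kegel graph, so a non-singleton component
    contains the orders of all vertices of some nontrivial tree.

    Let X, of order p, be a leaf of the forest and Y, of order q, its
    neighbour. Then C_G(X) is a {p,q}-group, and every nontrivial q-element v
    of C_G(X) has Y inside <v>; for x generating X the groups <v x> then all
    contain XY, so they form a chain. Hence the q-elements of C_G(X) form a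
    cyclic normal Sylow subgroup Z, and C_G(X) is the semidirect product of Z
    by a Sylow p-subgroup P ([leaf_structure]). Moreover C_P(Z) = C_P(Y) is the
    Sylow p-subgroup of C_G(XY), and its elements u with u^p <> 1 also generate
    a chain of subgroups. A p-group with this property is cyclic, of exponent
    p, or else p = 2 and it has a proper cyclic subgroup outside of which every
    element is an involution, that is, it is dihedral of order at least 8
    ([comparable_pgroup_cases]).

    The dihedral case does occur: X = Z(D_8) is a leaf for the power-chordal
    group D_8 x C_3. So the leaf has to be chosen well, and it is enough to find
    a vertex Y with a leaf neighbour, and all but at most one of whose
    neighbours are leaves (take the end of a longest path,
    [acyclic_near_leaf]), and to show that its leaves are not all of dihedral
    type. Suppose they are. A neighbour R of Y that is not a leaf is unique,
    hence normalised by C_G(Y). If |R| = 2 it is central in the dihedral group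
    attached to X, so it is X; if |R| is odd, every involution of C_G(Y) inverts
    R, which is absurd for two commuting involutions and their product. So all
    neighbours of Y are leaves and have order 2, and C_G(Y) is a {2,q}-group,
    which is solvable by Burnside's theorem. Every involution of C_G(Y) is then
    the central involution of a Sylow 2-subgroup of C_G(Y), so all of them are
    conjugate; solvability and the Frattini argument contradict this
    ([no_dihedral_like_cores]). *)

(** * Acyclic graphs *)

Definition acyclic (T : eqType) (e : rel T) : Prop :=
  forall v s, path e v s -> uniq (v :: s) -> 2 <= size s -> ~~ e (last v s) v.

Lemma acyclic_no_chord (T : eqType) (e : rel T) u v s w :
  acyclic e -> path e u (v :: s) -> uniq (u :: v :: s) -> w \in s -> ~~ e w u.
Proof.
move=> acyc path_s uniq_s /splitPr def_s.
case: def_s path_s uniq_s => s1 s2; rewrite -cat_rcons -!cat_cons => path_s uniq_s.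
move: path_s; rewrite cat_path => /andP[path1 _].
move: uniq_s; rewrite cat_uniq => /andP[uniq1 _].
have := acyc u (v :: rcons s1 w) path1 uniq1.
by rewrite /= last_rcons size_rcons; apply.
Qed.

(** The first vertex x of a longest simple path x, y, r, ... is a leaf, by
    maximality and acyclicity. A neighbour w of y other than r lies off the rest
    of the path, so w, y, r, ... is another longest path and w is a leaf too.
    When the path stops at y, the vertex y itself stands for r. *)
Lemma acyclic_near_leaf (T : finType) (e : rel T) (a b : T) :
    symmetric e -> irreflexive e -> acyclic e -> e a b ->
  exists y x r, [/\ connect e a y, e y x, x != r
    & forall w, e y w -> w != r -> forall z, e w z -> z = y].
Proof.
move=> sym_e irr_e acyc eab.
pose good v s := [&& connect e a v, path e v s & uniq (v :: s)].
pose P n := [exists v : T, exists t : n.-tuple T, good v t].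
have P1: P 1%N.
  apply/existsP; exists a; apply/existsP; exists [tuple b].
  rewrite /good connect0 /= eab inE !andbT.
  by apply: contraTN eab => /eqP->; rewrite irr_e.
have Pmax n : P n -> n <= #|T|.
  case/existsP=> v /existsP[t /and3P[_ _ /card_uniqP]] /= card_t.
  by have := max_card (mem (v :: t)); rewrite card_t size_tuple; apply: ltnW.
have [n Pn maxn] := ex_maxnP (ex_intro P 1%N P1) Pmax.
have maxP v s : good v s -> size s <= n.
  move=> good_s; apply: maxn; apply/existsP; exists v; apply/existsP.
  by exists (in_tuple s).
have n_gt0 := maxn _ P1.
have leafP w y s : good w (y :: s) -> size (y :: s) = n -> forall z, e w z -> z = y.
  case/and3P=> conw path_s uniq_s size_s z ewz; apply/eqP/idPn=> neq_zy.
  have [zs | nzs] := boolP (z \in w :: y :: s).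
    move: zs; rewrite !inE (negPf neq_zy) /= => /predU1P[eq_zw | zs].
      by rewrite eq_zw irr_e in ewz.
    by have:= acyclic_no_chord acyc path_s uniq_s zs; rewrite sym_e ewz.
  have /maxP : good z (w :: y :: s).
    rewrite /good (connect_trans conw (connect1 ewz)).
    rewrite (_ : path _ _ _ = e z w && path e w (y :: s)) // sym_e ewz path_s.
    by rewrite (_ : uniq _ = (z \notin w :: y :: s) && uniq (w :: y :: s)) // nzs uniq_s.
  by rewrite -size_s /= ltnn.
have /existsP[x /existsP[[s /= /eqP size_s] /= good_s]] := Pn.
case: s size_s good_s => [|y s] size_s good_s; first by rewrite -size_s in n_gt0.
have /and3P[conx path_s uniq_s] := good_s.
have exy : e x y by case/andP: path_s.
have path_ys : path e y s by case/andP: path_s.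
have uniq_ys : uniq (y :: s) by case/andP: uniq_s.
exists y, x, (head y s); split.
- exact: connect_trans conx (connect1 exy).
- by rewrite sym_e.
- have: x \notin y :: s by case/andP: uniq_s.
  by apply: contra => /eqP->; case: (s) => [|c s'] /=; rewrite !inE eqxx ?orbT.
move=> w eyw neq_wr.
apply: (@leafP w y s) => //; apply/and3P; split.
- apply: connect_trans conx (connect_trans (connect1 exy) (connect1 eyw)).
- by rewrite /= sym_e eyw.
rewrite (_ : uniq _ = (w \notin y :: s) && uniq (y :: s)) // uniq_ys andbT inE negb_or.
apply/andP; split; first by apply: contraTneq eyw => ->; rewrite irr_e.
case: s path_ys uniq_ys neq_wr {size_s good_s path_s uniq_s} => //= c s path_ys uniq_ys.
move=> neq_wc; rewrite inE negb_or neq_wc /=; apply/negP=> ws.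
by have := acyclic_no_chord acyc path_ys uniq_ys ws; rewrite sym_e eyw.
Qed.

(** * Induced cycles in power graphs *)

Lemma modS i k : i < k -> i.+1 %% k = if i.+1 == k then 0 else i.+1.
Proof.
by move=> lik; case: eqP => [-> | /eqP neq]; rewrite ?modnn // modn_small // ltn_neqAle neq.
Qed.

Lemma power_adjP (gT : finGroupType) (x y : gT) :
  power_adj x y <-> x <> y /\ (y \in <[x]> \/ x \in <[y]>).
Proof.
have powP (u v : gT) : (exists m, u ^+ m = v) <-> v \in <[u]>.
  by split=> [[m <-] | /cycleP[m ->]]; [apply: mem_cycle | exists m].
by rewrite /power_adj !powP.
Qed.

(** The general form of a forbidden cycle b_0, a_0, b_1, a_1, ..., with tops a_i
    and bottoms b_i. That no top is a power of a bottom b_j need not be assumed: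
    otherwise both b_i and b_(i+1) would be powers of b_j. *)
Lemma no_zigzag (gT : finGroupType) (G : {group gT}) k (a b : nat -> gT) :
    power_chordal G -> 2 <= k ->
    (forall i, i < k -> a i \in G) -> (forall i, i < k -> b i \in G) ->
    (forall i j, i < k -> j < k ->
       (b j \in <[a i]>) = (j == i) || (j == i.+1 %% k)) ->
    (forall i j, i < k -> j < k -> b i \in <[b j]> -> i = j) ->
    (forall i j, i < k -> j < k -> a i \in <[a j]> -> i = j) ->
  False.
Proof.
move=> chG k_gt1 aG bG in_ab incb inca.
have nab i j : i < k -> j < k -> a i \notin <[b j]>.
  move=> lik ljk; apply/negP; rewrite -cycle_subG => /subsetP sab.
  have lSk: i.+1 %% k < k by rewrite ltn_mod; lia.
  have /incb Ei: b i \in <[b j]> by rewrite sab ?in_ab ?eqxx.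
  have /incb ESi: b (i.+1 %% k) \in <[b j]> by rewrite sab ?in_ab ?eqxx ?orbT.
  have:= Ei lik ljk; have:= ESi lSk ljk; rewrite modS //; case: eqP; lia.
have half_lt (i : 'I_k.*2) : i./2 < k by have:= ltn_ord i; lia.
(* Bottoms sit at the even places and tops at the odd ones. *)
pose c (i : 'I_k.*2) := if odd i then a i./2 else b i./2.
have ordSE (i : 'I_k.*2) : ordS i = (if i.+1 == k.*2 then 0 else i.+1) :> nat.
  by rewrite /= modS.
have adjE (i j : 'I_k.*2) : odd i -> ~~ odd j ->
    b j./2 \in <[a i./2]> <-> (j = ordS i \/ i = ordS j).
  move=> oi oj; rewrite in_ab // modS //.
  have -> : (j = ordS i \/ i = ordS j) <->
           (j = ordS i :> nat \/ i = ordS j :> nat).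
    by split=> [[->|->]|[/val_inj|/val_inj]]; auto.
  rewrite !ordSE; have := ltn_ord i; have := ltn_ord j.
  have := odd_double_half i; have := odd_double_half j; rewrite oi (negPf oj).
  move: (half_lt i) (half_lt j) (i./2) (j./2) => _ _ i' j' Ej Ei ljk lik.
  by case: ifP => E1; case: ifP => E2; case: ifP => E3; split; lia.
have injc : injective c.
  move=> i j; rewrite /c; case oi: (odd i); case oj: (odd j) => Ec; apply/val_inj.
  - have /inca E: a i./2 \in <[a j./2]> by rewrite Ec cycle_id.
    by rewrite -[LHS]odd_double_half -[RHS]odd_double_half oi oj E.
  - by have := nab _ _ (half_lt i) (half_lt j); rewrite Ec cycle_id.
  - by have := nab _ _ (half_lt j) (half_lt i); rewrite -Ec cycle_id.
  have /incb E: b i./2 \in <[b j./2]> by rewrite Ec cycle_id.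
  by rewrite -[LHS]odd_double_half -[RHS]odd_double_half oi oj E.
apply: (chG k.*2 c); first lia.
split=> // [i | i j]; first by rewrite /c; case: ifP; auto.
have parity_ordS (u v : 'I_k.*2) : v = ordS u -> odd u <> odd v.
  move/(congr1 val); rewrite [RHS]ordSE; case: eqP => [Eu | _] /= ->.
    by have := oddS u; rewrite Eu odd_double; case: odd.
  by rewrite oddS; case: odd.
have same_parity (u v : 'I_k.*2) : odd u = odd v -> ~ (v = ordS u \/ u = ordS v).
  by move=> Euv [/parity_ordS | /parity_ordS]; rewrite Euv.
rewrite power_adjP; case oi: (odd i); case oj: (odd j).
- split=> [[neq_c in_c] | /same_parity[]]; last by rewrite oi oj.
  case: neq_c; rewrite /c oi oj in in_c *.
  by case: in_c => /inca E; rewrite (E (half_lt _) (half_lt _)).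
- have adj := adjE i j oi (negbT oj); rewrite -adj /c oi oj; split=> [[_ []] // | bj].
    by rewrite (negPf (nab _ _ (half_lt i) (half_lt j))).
  split; last by left.
  by move=> E; have := nab _ _ (half_lt i) (half_lt j); rewrite E cycle_id.
- have adj := adjE j i oj (negbT oi); rewrite or_comm in adj.
  rewrite -adj /c oi oj; split=> [[_ []] // | bj].
    by rewrite (negPf (nab _ _ (half_lt j) (half_lt i))).
  split; last by right.
  by move=> E; have := nab _ _ (half_lt j) (half_lt i); rewrite -E cycle_id.
split=> [[neq_c in_c] | /same_parity[]]; last by rewrite oi oj.
case: neq_c; rewrite /c oi oj in in_c *.
by case: in_c => /incb E; rewrite (E (half_lt _) (half_lt _)).
Qed.

(** Otherwise a, b, c, d is an induced 4-cycle. *)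
Lemma cyclic_meet_comparable (gT : finGroupType) (G : {group gT}) a c b d :
    power_chordal G -> a \in G -> c \in G ->
    b \in <[a]> :&: <[c]> -> d \in <[a]> :&: <[c]> ->
    b \notin <[d]> -> d \notin <[b]> ->
  a \in <[c]> \/ c \in <[a]>.
Proof.
move=> chG aG cG /setIP[ba bc] /setIP[da dc] nbd ndb.
have sub2G u v : u \in G -> v \in G -> forall i : nat, i < 2 -> (if i == 0 then u else v) \in G.
  by move=> uG vG i _; case: ifP.
apply/orP/idPn; rewrite negb_or => /andP[nac nca].
apply: (@no_zigzag _ G 2 (fun i => if i == 0 then a else c)
                  (fun i => if i == 0 then b else d) chG) => //.
- exact: sub2G.
- have /subsetP sAG : <[a]> \subset G by rewrite cycle_subG.
  by apply: sub2G; apply: sAG.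
- by move=> [|[|//]] [|[|//]] _ _ /=; rewrite ?ba ?bc ?da ?dc.
- by move=> [|[|//]] [|[|//]] _ _ //=; rewrite ?(negPf nbd) ?(negPf ndb).
by move=> [|[|//]] [|[|//]] _ _ //=; rewrite ?(negPf nac) ?(negPf nca).
Qed.

(** * The forest of subgroups of prime order *)

Definition linked (gT : finGroupType) (G : {group gT}) : rel {group gT} :=
  fun A B => [&& A \subset G, B \subset G, prime #|A|, prime #|B|,
                 #|A| != #|B| & A \subset 'C(B)].

Lemma linked_sym (gT : finGroupType) (G : {group gT}) : symmetric (linked G).
Proof.
move=> A B; rewrite /linked eq_sym centsC.
by case: (A \subset G); case: (B \subset G); case: (prime #|A|); case: (prime _).
Qed.

Lemma linked_irr (gT : finGroupType) (G : {group gT}) : irreflexive (linked G).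
Proof. by move=> A; rewrite /linked eqxx !andbF. Qed.

Lemma linkedP (gT : finGroupType) (G A B : {group gT}) :
  reflect [/\ A \subset G /\ B \subset G, prime #|A|, prime #|B|,
              #|A| <> #|B| & A \subset 'C(B)] (linked G A B).
Proof.
apply: (iffP and5P) => [[sAG sBG prA prB /andP[/eqP neqAB cAB]] //|].
case=> [[sAG sBG] prA prB /eqP neqAB cAB].
by split=> //; apply/andP.
Qed.

Lemma prime_card_cyclic_eq (gT : finGroupType) (K A B : {group gT}) :
  cyclic K -> A \subset K -> B \subset K -> #|A| = #|B| -> A = B.
Proof.
by move=> cycK sAK sBK eqAB; apply/val_inj/eqP; rewrite /= (eq_subG_cyclic cycK) ?eqAB.
Qed.

Lemma linked_coprime (gT : finGroupType) (G A B : {group gT}) :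
  linked G A B -> coprime #|A| #|B|.
Proof.
case/linkedP=> _ prA prB neqAB _.
by rewrite prime_coprime // dvdn_prime2 //; apply/eqP.
Qed.

Lemma linked_sub_prime (gT : finGroupType) (G A B W : {group gT}) :
  linked G A B -> prime #|W| -> W \subset A * B -> W = A \/ W = B.
Proof.
move=> linkAB prW; have [_ prA prB neqAB cAB] := linkedP _ _ _ linkAB.
have coAB := linked_coprime linkAB.
have cycAB : cyclic (A <*> B).
  by apply: cyclicY; rewrite ?prime_cyclic // centsC.
rewrite -(cent_joinEl cAB) => sWAB.
have : #|W| %| #|A| * #|B| by rewrite -coprime_cardMg // -(cent_joinEl cAB) cardSg.
by rewrite Euclid_dvdM // !dvdn_prime2 // => /orP[] /eqP eqW; [left | right];
  apply: (prime_card_cyclic_eq cycAB); rewrite ?joing_subl ?joing_subr.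
Qed.

Lemma linked_mul_cycle (gT : finGroupType) (G : {group gT}) (a b : gT) :
  linked G <[a]> <[b]> -> <[a * b]> = <[a]> * <[b]>.
Proof.
move=> linkab; apply: cycleM (linked_coprime linkab).
by have [_ _ _ _ /centsP] := linkedP _ _ _ linkab; apply; apply: cycle_id.
Qed.

(** A cycle A_0, ..., A_(k-1) of linked subgroups lifts to an induced cycle of
    length 2k. Its tops generate the products A_i A_(i+1), in which A_i and
    A_(i+1) are the only subgroups of prime order; since k > 2, the pair
    {i, i+1} determines i modulo k, so that the tops are incomparable. *)
Lemma linked_acyclic (gT : finGroupType) (G : {group gT}) :
  power_chordal G -> acyclic (linked G).
Proof.
move=> chG v s path_s uniq_s s_gt1; apply/negP=> link_last.
pose k := (size s).+1; pose A i := nth v (v :: s) i.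
have linkA i : i < k -> linked G (A i) (A (i.+1 %% k)).
  rewrite ltnS leq_eqVlt => /predU1P[-> | lis].
    by rewrite modnn /A (last_nth v) in link_last *.
  by rewrite modn_small ?ltnS //; apply: (pathP v path_s).
have injA i j : i < k -> j < k -> A i = A j -> i = j.
  by move=> lik ljk /eqP; rewrite nth_uniq // => /eqP.
have lSk i : i.+1 %% k < k by rewrite ltn_mod.
have prA i : i < k -> prime #|A i| by case/linkA/linkedP.
pose gen (H : {group gT}) : gT := odflt 1 [pick x | H :==: <[x]>].
have genA i : i < k -> <[gen (A i)]>%G = A i.
  move=> lik; apply/val_inj; rewrite /gen /=; case: pickP => [x /eqP-> // | no_x].
  by have [x defA] := cyclicP (prime_cyclic (prA i lik)); have := no_x x; rewrite defA eqxx.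
pose b i := gen (A i); pose a i := b i * b (i.+1 %% k).
have bS i : i < k -> <[b i]> = A i by move=> lik; rewrite -[RHS](congr_group (genA i lik)).
have bE i (H : {group gT}) : i < k -> (b i \in H) = (A i \subset H).
  by move=> lik; rewrite -cycle_subG bS.
have aE i : i < k -> <[a i]> = A i * A (i.+1 %% k).
  by move=> lik; rewrite (@linked_mul_cycle _ G) ?bS // ?genA ?linkA.
have in_ab i j : i < k -> j < k -> (b j \in <[a i]>) = (j == i) || (j == i.+1 %% k).
  move=> lik ljk; rewrite -cycle_subG bS //= aE //; apply/idP/idP.
    by case/(linked_sub_prime (linkA i lik) (prA j ljk))=> /injA->; rewrite ?eqxx ?orbT.
  by case/orP=> /eqP->; rewrite ?mulG_subl ?mulG_subr.
apply: (@no_zigzag _ G k a b) => // [|i lik|i lik|i j lik ljk|i j lik ljk].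
- exact: leq_trans s_gt1 _.
- have [[sA sA'] _ _ _ _] := linkedP _ _ _ (linkA i lik).
  by rewrite groupM // bE.
- by have [[sA sA'] _ _ _ _] := linkedP _ _ _ (linkA i lik); rewrite bE.
- rewrite -cycle_subG /= !bS // => sAij.
  apply: injA => //; apply: (prime_card_cyclic_eq (prime_cyclic (prA j ljk))) => //.
  by have := cardSg sAij; rewrite dvdn_prime2 ?prA // => /eqP.
rewrite -cycle_subG => /subsetP saij.
have bi : b i \in <[a j]> by rewrite saij // in_ab ?eqxx.
have bSi : b (i.+1 %% k) \in <[a j]> by rewrite saij // in_ab ?eqxx ?orbT.
rewrite in_ab // modS // in bi; rewrite (in_ab _ _ ljk (lSk i)) (modS lik) (modS ljk) in bSi.
have k_gt2 : 2 < k by [].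
move: bi bSi; clearbody k; clear -lik ljk k_gt2.
by case: (i.+1 =P k); case: (j.+1 =P k); lia.
Qed.

(** * Chains of cyclic subgroups *)

Lemma mem_cycle_mul_constt (gT : finGroupType) (p : nat_pred) (u v y : gT) :
    commute v y -> p.-elt v -> p^'.-elt y -> p.-elt u ->
  u \in <[v * y]> -> u \in <[v]>.
Proof.
move=> cvy pv p'y pu /cycleP[k def_u]; rewrite -(constt_p_elt pu) def_u consttX.
by rewrite consttM // (constt_p_elt pv) (constt1P p'y) mulg1 mem_cycle.
Qed.

(** The cyclic groups <u y> and <v y> both contain b and y, which are
    incomparable because their orders are coprime. So one contains the other,
    and taking p-parts compares <u> with <v>. *)
Lemma p_elts_comparable (gT : finGroupType) (G : {group gT}) (p : nat_pred) (u v y b : gT) :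
    power_chordal G -> u \in G -> v \in G -> y \in G ->
    commute u y -> commute v y -> p.-elt u -> p.-elt v -> p^'.-elt y -> y != 1 ->
    b \in <[u]> :&: <[v]> -> b != 1 ->
  u \in <[v]> \/ v \in <[u]>.
Proof.
move=> chG uG vG yG cuy cvy pu pv p'y nty /setIP[bu bv] ntb.
have co_mem w : commute w y -> p.-elt w -> w \in <[w * y]> /\ y \in <[w * y]>.
  move=> cwy pw; have p''w : p^'^'.-elt w by rewrite p_eltNK.
  have := cycle_constt p (w * y); have := cycle_constt p^' (w * y).
  rewrite !consttM // (constt_p_elt pw) (constt_p_elt p'y) (constt1P p'y).
  by rewrite (constt1P p''w) mul1g mulg1 => yy ww; split.
have [uuy yuy] := co_mem u cuy pu; have [vvy yvy] := co_mem v cvy pv.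
have pb : p.-elt b by apply: mem_p_elt bu.
have disj z t : p.-elt z -> p^'.-elt t -> z \in <[t]> -> z = 1.
  by move=> pz p't /(mem_p_elt p't) p'z; rewrite -(constt_p_elt pz) (constt1P p'z).
have [] := @cyclic_meet_comparable _ G (u * y) (v * y) b y chG.
- by rewrite groupM.
- by rewrite groupM.
- by apply/setIP; split; [move: bu | move: bv]; apply: subsetP; rewrite cycle_subG.
- by rewrite inE yuy yvy.
- by apply: contra ntb => /disj->.
- apply: contra nty => yb; apply/eqP; rewrite -(constt_p_elt p'y); apply/constt1P.
  by rewrite p_eltNK; apply: mem_p_elt yb.
- move=> in_uv; left; apply: mem_cycle_mul_constt (pv) p'y (pu) _ => //.
  by apply: subsetP uuy; rewrite cycle_subG.
move=> in_vu; right; apply: mem_cycle_mul_constt (pu) p'y (pv) _ => //.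
by apply: subsetP vvy; rewrite cycle_subG.
Qed.

Lemma prime_sub_cyclic_pgroup (gT : finGroupType) (p : nat) (K A H : {group gT}) :
    cyclic K -> p.-group K -> A \subset K -> prime #|A| -> H \subset K -> H :!=: 1 ->
  A \subset H.
Proof.
move=> cycK pK sAK prA sHK ntH.
have [p_pr pH _] := pgroup_pdiv (pgroupS sHK pK) ntH.
have eqAp : #|A| = p.
  have [] := pgroup_pdiv (pgroupS sAK pK); first by rewrite -cardG_gt1 prime_gt1.
  by move=> _ pA _; apply/esym/eqP; rewrite -dvdn_prime2.
have [x xH ox] := Cauchy p_pr pH.
rewrite (_ : A = <[x]>%G) ?cycle_subG //.
by apply: (prime_card_cyclic_eq cycK); rewrite ?cycle_subG ?(subsetP sHK) // eqAp -ox.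
Qed.

(** By coprime action A has no nontrivial fixed point in [Z, A]; but if [Z, A]
    were nontrivial it would contain Y, the only subgroup of Z of its order. *)
Lemma coprime_cyclic_cent_prime (gT : finGroupType) (q : nat) (Z A Y : {group gT}) :
    cyclic Z -> q.-group Z -> A \subset 'N(Z) -> coprime #|Z| #|A| ->
    Y \subset Z -> prime #|Y| -> A \subset 'C(Y) ->
  A \subset 'C(Z).
Proof.
move=> cycZ qZ nZA coZA sYZ prY cYA.
rewrite centsC; apply/commG1P/eqP; apply: contraTT (prY) => ntZA.
have sYZA : Y \subset [~: Z, A].
  by apply: (@prime_sub_cyclic_pgroup _ q Z Y [~: Z, A]%G); rewrite ?commg_subl.
have: Y \subset 'C_[~: Z, A](A) by rewrite subsetI sYZA centsC.
by rewrite coprime_abel_cent_TI ?cyclic_abelian // => /trivgP->; rewrite cards1.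
Qed.

(** * Centralisers of leaves *)

Definition leaf (gT : finGroupType) (G X Y : {group gT}) : bool :=
  linked G X Y && [forall W : {group gT}, linked G X W ==> (W == Y)].

Lemma leafP (gT : finGroupType) (G X Y : {group gT}) :
  reflect (linked G X Y /\ forall W, linked G X W -> W = Y) (leaf G X Y).
Proof.
apply: (iffP andP) => [[lXY /forallP leafX] | [lXY leafX]]; split=> //.
  by move=> W lXW; apply/eqP/(implyP (leafX W)).
by apply/forallP=> W; apply/implyP=> /leafX->.
Qed.

Lemma leaf_order_eq (gT : finGroupType) (G X Y : {group gT}) (w : gT) :
    leaf G X Y -> w \in 'C_G(X) -> prime #[w] -> #[w] <> #|X| ->
  <[w]> = Y.
Proof.
case/leafP=> /linkedP[[sXG sYG] prX prY _ _] leafX /setIP[wG cXw] prw neqwX.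
suffices /leafX <- : linked G X <[w]>%G by [].
apply/linkedP; split; rewrite ?cycle_subG //; first by move/esym.
by rewrite centsC cycle_subG.
Qed.

Lemma leaf_sub_cycle (gT : finGroupType) (G X Y : {group gT}) (v : gT) :
    leaf G X Y -> v \in 'C_G(X) -> #|Y|.-elt v -> v != 1 ->
  Y \subset <[v]>.
Proof.
move=> leafX Cv qv ntv; have [/linkedP[_ prX prY neqXY _] _] := leafP _ _ _ leafX.
have [_ q_dv _] : [/\ prime #|Y|, #|Y| %| #|<[v]>| & exists m, #|<[v]>| = (#|Y| ^ m.+1)%N].
  by apply: pgroup_pdiv; rewrite ?cycle_eq1.
have [w wv ow] := Cauchy prY q_dv.
have Cw : w \in 'C_G(X) by apply: subsetP wv; rewrite cycle_subG.
by rewrite -(leaf_order_eq leafX Cw) ?ow ?cycle_subG // => /esym.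
Qed.

(** An element of C_G(X) of prime order r other than |X| generates a subgroup
    linked to X, so it generates Y and r = |Y|. *)
Lemma leaf_cent_pi (gT : finGroupType) (G X Y : {group gT}) :
  leaf G X Y -> {in \pi('C_G(X)), #|Y|^' =i (#|X| : nat_pred)}.
Proof.
move=> leafX r; rewrite mem_primes => /and3P[prr _ /(Cauchy prr)[w Cw ow]].
have [/linkedP[_ prX prY neqXY _] _] := leafP _ _ _ leafX.
rewrite !inE /=; have [-> | /eqP neqrX] := eqVneq r #|X|; first exact/eqP.
by apply/negbTE; rewrite negbK -(leaf_order_eq leafX Cw) ?ow // -orderE ow.
Qed.

(** Any two nontrivial q-elements v and w of C_G(X) have Y in both <v> and <w>,
    so they are comparable by [p_elts_comparable], applied with a generator of X
    as the commuting p-element. Hence all q-elements are powers of one of maximal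
    order. *)
Lemma leaf_cent_Hall (gT : finGroupType) (G X Y : {group gT}) :
    power_chordal G -> leaf G X Y ->
  exists Z : {group gT}, [/\ cyclic Z, Z <| 'C_G(X) & #|Y|.-Sylow('C_G(X)) Z].
Proof.
move=> chG leafX; have [/linkedP[[sXG sYG] prX prY neqXY _] _] := leafP _ _ _ leafX.
set q := #|Y| in leafX *; have [x defX] := cyclicP (prime_cyclic prX).
have [y defY] := cyclicP (prime_cyclic prY).
pose S := [pred v in 'C_G(X) | q.-elt v].
have S1 : S 1 by rewrite /= group1 p_elt1.
pose v0 := [arg max_(v > 1 | S v) #[v]].
have [/andP[/= Cv0 qv0] maxv0] : S v0 /\ forall v, S v -> #[v] <= #[v0].
  by rewrite /v0; case: arg_maxnP => // v Sv maxv.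
have v0max v : S v -> v \in <[v0]>.
  move=> Sv; have /andP[/= Cv qv] := Sv.
  have [-> | ntv] := eqVneq v 1; first exact: group1.
  have ntv0 : v0 != 1.
    apply: contraTneq (maxv0 v Sv) => ->.
    by rewrite order1 -ltnNge order_gt1.
  have comm_x w : w \in 'C_G(X) -> commute w x.
    by case/setIP=> _; rewrite defX cent_cycle => /cent1P.
  have [] // := @p_elts_comparable _ G q v v0 x y chG.
  - by case/setIP: Cv.
  - by case/setIP: Cv0.
  - by rewrite -cycle_subG -defX.
  - exact: comm_x.
  - exact: comm_x.
  - by rewrite /p_elt orderE -defX pnatE // !inE; apply/eqP.
  - by rewrite -order_gt1 orderE -defX prime_gt1.
  - by rewrite inE -!cycle_subG -defY !(leaf_sub_cycle leafX).
  - by rewrite -order_gt1 orderE -defY prime_gt1.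
  rewrite -!cycle_subG => sv0v; suffices -> : <[v]> = <[v0]> by [].
  by apply/esym/eqP; rewrite eqEcard sv0v -!orderE maxv0.
exists <[v0]>%G; split; first exact: cycle_cyclic.
  rewrite /normal cycle_subG Cv0; apply/subsetP=> g Cg; rewrite inE -cycleJ cycle_subG.
  by apply: v0max; rewrite /= groupJ // p_eltJ.
have [Z sylZ] := Sylow_exists q 'C_G(X).
rewrite /= (sub_pHall sylZ (_ : q.-group <[v0]>)) ?cycle_subG //=.
apply/subsetP=> z Zz; apply: v0max; rewrite /= (subsetP (pHall_sub sylZ)) //.
exact: mem_p_elt (pHall_pgroup sylZ) Zz.
Qed.

(** For a leaf X with neighbour Y this is the group C_P(Z) of the decomposition
    of C_G(X) in [leaf_structure]; the present form does not involve the choice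
    of P. *)
Definition leaf_core (gT : finGroupType) (G X Y : {group gT}) : {group gT} :=
  'O_(#|X|)('C_('C_G(Y))(X))%G.

(** Since C_P(Y) = C_P(Z), Dedekind's law gives C_G(XY) = Z C_P(Z), a direct
    product, and C_P(Z) is its normal Sylow subgroup. *)
Lemma leaf_structure (gT : finGroupType) (G X Y : {group gT}) :
    power_chordal G -> leaf G X Y ->
  (exists Z P : {group gT}, [/\ 'C_G(X) = Z ><| P, cyclic Z, #|Y|.-group Z,
     #|X|.-group P & 'C_P(Z) = leaf_core G X Y])
  /\ #|X|.-Sylow('C_('C_G(Y))(X)) (leaf_core G X Y).
Proof.
move=> chG leafX; have [/linkedP[[sXG sYG] prX prY neqXY cXY] _] := leafP _ _ _ leafX.
have [Z [cycZ nsZC sylZ]] := leaf_cent_Hall chG leafX.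
have [P sylP] := Sylow_exists #|X| 'C_G(X).
have pP := pHall_pgroup sylP; have qZ := pHall_pgroup sylZ.
have sylP' : #|Y|^'.-Hall('C_G(X)) P by rewrite (eq_in_pHall _ (leaf_cent_pi leafX)).
have defC : Z ><| P = 'C_G(X) by apply/(sdprod_normal_p'HallP nsZC sylP').
have [_ mulZP nZP _] := sdprodP defC.
have sYZ : Y \subset Z.
  rewrite (sub_normal_Hall sylZ nsZC) ?subsetI ?sYG ?pgroup_pi //; last by rewrite centsC.
  by rewrite /pgroup pnat_id.
have cPYZ : 'C_P(Y) = 'C_P(Z).
  apply/eqP; rewrite eqEsubset andbC setIS ?centS //= subsetI subsetIl /=.
  apply: (@coprime_cyclic_cent_prime _ #|Y| Z 'C_P(Y)%G Y) => //.
  - by rewrite subIset ?nZP.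
  - apply: pnat_coprime qZ (pgroupS (subsetIl _ _) (pHall_pgroup sylP')).
  exact: subsetIr.
have defM : Z * 'C_P(Z) = 'C_('C_G(Y))(X).
  rewrite -cPYZ group_modl; last by rewrite centsC (subset_trans sYZ) // -abelianE cyclic_abelian.
  by rewrite mulZP setIAC.
have nsQM : 'C_P(Z) <| 'C_('C_G(Y))(X).
  rewrite /normal -defM mulG_subr mul_subG ?normG //.
  by apply: subset_trans (cent_sub _); rewrite centsC subsetIr.
have [_ sylQ] := coprime_mulpG_Hall defM qZ (pgroupS (subsetIl _ _) (pHall_pgroup sylP')).
have sylQX : #|X|.-Sylow('C_('C_G(Y))(X)) 'C_P(Z).
  rewrite -(eq_in_pHall _ (pi := #|Y|^')) // => r pi_r.
  by apply: (leaf_cent_pi leafX); apply: piSg pi_r; rewrite setSI ?subsetIl.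
have defQ : leaf_core G X Y = 'C_P(Z) :> {set gT} by apply: normal_Hall_pcore.
by split; [exists Z, P; rewrite defQ | rewrite defQ].
Qed.

(** If u has maximal order among the elements with u^p <> 1, then <u> contains
    all of these and is normal in Q, and every element outside <u> has p-th
    power 1. For odd p, let u1 have order p^2 in <u> and let w lie outside <u>.
    The group <u1, w> has order at most p^3, hence class at most 2, so the
    elements in it with p-th power 1 form a subgroup. That subgroup contains w
    and u1 w, hence u1, which is absurd. *)
Lemma comparable_pgroup_cases (gT : finGroupType) (p : nat) (Q : {group gT}) :
    prime p -> p.-group Q ->
    (forall u v, u \in Q -> v \in Q -> u ^+ p != 1 -> v ^+ p != 1 ->
       u \in <[v]> \/ v \in <[u]>) ->
    ~~ cyclic Q -> exponent Q != p ->
  p = 2 /\ exists u, [/\ u \in Q, u ^+ p != 1, ~~ (Q \subset <[u]>)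
                      & forall w, w \in Q -> w \notin <[u]> -> w ^+ p = 1].
Proof.
move=> prp pQ comp ncycQ expQ.
have [u0 Qu0 u0p] : exists2 u, u \in Q & u ^+ p != 1.
  apply/exists_inP/exists_inPn => exp1; case/negP: expQ.
  have : exponent Q %| p by apply/exponentP=> x Qx; apply/eqP/negPn/exp1.
  case/primeP: prp => _ /(_ (exponent Q)) h /h /orP[] // /eqP exp_eq1.
  case/negP: ncycQ; rewrite (_ : Q :=: 1) ?cyclic1 //.
  by apply/eqP; rewrite trivg_exponent exp_eq1.
pose S := [pred u in Q | u ^+ p != 1].
have Su0 : S u0 by rewrite /= Qu0.
pose u := [arg max_(v > u0 | S v) #[v]].
have [/andP[/= Qu up] maxu] : S u /\ forall v, S v -> #[v] <= #[u].
  by rewrite /u; case: arg_maxnP => // v Sv maxv.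
have in_u v : v \in Q -> v ^+ p != 1 -> v \in <[u]>.
  move=> Qv vp; have [// | ] := comp v u Qv Qu vp up.
  rewrite -!cycle_subG => suv; suffices -> : <[v]> = <[u]> by [].
  by apply/esym/eqP; rewrite eqEcard suv -!orderE maxu //= Qv.
have out_u w : w \in Q -> w \notin <[u]> -> w ^+ p = 1.
  by move=> Qw; apply: contraNeq; apply: in_u.
have nsuQ : Q \subset 'N(<[u]>).
  apply/subsetP=> g Qg; rewrite inE -cycleJ cycle_subG in_u ?groupJ //.
  by rewrite -conjXg -(conj1g g) (inj_eq (conjg_inj g)).
have nsQu : ~~ (Q \subset <[u]>).
  by apply: contra ncycQ => /cyclicS; apply; apply: cycle_cyclic.
split; last by exists u.
apply/eqP/idPn=> p_neq2; have odd_p : odd p.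
  by have [eqp2 | //] := even_prime prp; rewrite eqp2 in p_neq2.
have [w Qw nuw] := subsetPn nsQu.
have pu : p.-elt u := mem_p_elt pQ Qu.
have p2u : p ^ 2 %| #[u].
  have [n ou] := p_natP pu; rewrite ou dvdn_exp2l // ltnNge; apply: contra up => n_le1.
  by rewrite -order_dvdn ou -{2}(expn1 p) dvdn_exp2l.
pose u1 := u ^+ (#[u] %/ p ^ 2).
have ou1 : #[u1] = (p ^ 2)%N.
  by rewrite orderXdiv ?dvdn_div // divnA // mulKn ?order_gt0.
pose H := (<[u1]> <*> <[w]>)%G.
have Qu1 : u1 \in Q by rewrite groupX.
have sHQ : H \subset Q by rewrite join_subG !cycle_subG Qu1.
have nu1w : <[w]> \subset 'N(<[u1]>).
  rewrite cycle_subG; apply: subsetP Qw.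
  by apply: char_norm_trans nsuQ; rewrite cycle_subgroup_char // cycleX.
have oH : #|H| %| p ^ 3.
  have w_dv : #[w] %| p by rewrite order_dvdn out_u.
  rewrite /= norm_joinEr // (@dvdn_trans (#[u1] * #[w])) //.
    by rewrite orderE [#[w]]orderE mul_cardG dvdn_mulr.
  by rewrite ou1 (expnSr p 2) dvdn_mul.
have pH : p.-group H := pgroupS sHQ pQ.
have class_H : nil_class H <= 2.
  apply: leq_trans (nil_class_pgroup pH) _; rewrite geq_max /= -subn1 leq_subLR.
  by have := dvdn_leq_log p (_ : 0 < p ^ 3) oH; rewrite expn_gt0 prime_gt0 // pfactorK //; apply.
have /exponentP expH := exponent_Ohm1_class2 odd_p pH class_H.
have ohmH z : z \in H -> z ^+ p = 1 -> z \in 'Ohm_1(H).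
  by move=> Hz zp; rewrite (OhmE 1 pH) mem_gen // !inE Hz expn1 zp eqxx.
have Hw : w \in H by rewrite mem_gen // inE cycle_id orbT.
have Hu1 : u1 \in H by rewrite mem_gen // inE cycle_id.
have ohm_w : w \in 'Ohm_1(H) by rewrite ohmH ?out_u.
have ohm_uw : u1 * w \in 'Ohm_1(H).
  rewrite ohmH ?groupM // out_u //; first exact: groupM.
  by rewrite groupMl // mem_cycle.
have : u1 ^+ p = 1 by apply: expH; rewrite -(groupMr _ ohm_w).
move/eqP; rewrite -order_dvdn ou1 => /dvdn_leq -/(_ (prime_gt0 prp)).
by rewrite leqNgt -{1}(expn1 p) ltn_exp2l ?prime_gt1.
Qed.

(** What the endgame needs to know about a dihedral 2-group Q of order at least 8
    with centre X: its central involutions lie in X, it has other involutions,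
    and it is generated by its involutions. *)
Definition dihedral_like (gT : finGroupType) (X Q : {group gT}) : Prop :=
  [/\ forall t, t \in 'Z(Q) -> t ^+ 2 = 1 -> t \in X,
      exists2 w, w \in Q & w ^+ 2 = 1 /\ w \notin X
    & forall H : {group gT}, (forall w, w \in Q -> w ^+ 2 = 1 -> w \in H) -> Q \subset H].

Lemma leaf_core_normal (gT : finGroupType) (G X Y : {group gT}) :
  leaf_core G X Y <| 'C_('C_G(Y))(X).
Proof. exact: pcore_normal. Qed.

Lemma leaf_sub_core (gT : finGroupType) (G X Y : {group gT}) :
  leaf G X Y -> X \subset leaf_core G X Y.
Proof.
case/leafP=> /linkedP[[sXG _] prX _ _ cXY] _.
apply: pcore_max; first by rewrite /pgroup pnat_id.
rewrite /normal !subsetI sXG cXY /= -abelianE cyclic_abelian ?prime_cyclic //=.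
by apply: subset_trans (cent_sub _); rewrite subsetIr.
Qed.

(** The generators x of X and y of Y make [p_elts_comparable] available twice.
    Applied to u and u x, which have the same p-th power, it shows that x is
    a power of u as soon as u^p <> 1. So x is a common power of any two such
    elements, which are therefore comparable. *)
Lemma leaf_core_cases (gT : finGroupType) (G X Y : {group gT}) :
    power_chordal G -> leaf G X Y ->
    ~~ cyclic (leaf_core G X Y) -> exponent (leaf_core G X Y) != #|X| ->
  #|X| = 2 /\ dihedral_like X (leaf_core G X Y).
Proof.
move=> chG leafX; have sXQ := leaf_sub_core leafX.
have [/linkedP[[sXG sYG] prX prY neqXY cXY] _] := leafP _ _ _ leafX.
set Q := leaf_core G X Y in sXQ *.
have sQM : Q \subset 'C_('C_G(Y))(X) := normal_sub (leaf_core_normal G X Y).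
have pQ : #|X|.-group Q by apply: pcore_pgroup.
set p := #|X| in pQ prX neqXY *; have [x defX] := cyclicP (prime_cyclic prX).
have [y defY] := cyclicP (prime_cyclic prY).
have comm_x u : u \in Q -> commute u x.
  by move/(subsetP sQM)=> /setIP[_]; rewrite defX cent_cycle => /cent1P.
have comm_y u : u \in Q -> commute u y.
  by move/(subsetP sQM)=> /setIP[/setIP[_]]; rewrite defY cent_cycle => /cent1P.
have QG u : u \in Q -> u \in G by move/(subsetP sQM)=> /setIP[/setIP[]].
have Qx : x \in Q by rewrite -cycle_subG -defX.
have yG : y \in G by rewrite -cycle_subG -defY.
have ntx : x != 1 by rewrite -order_gt1 orderE -defX prime_gt1.
have nty : y != 1 by rewrite -order_gt1 orderE -defY prime_gt1.
have ox : #[x] = p by rewrite orderE -defX.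
have p'y : p^'.-elt y by rewrite /p_elt orderE -defY pnatE // !inE; apply/eqP/nesym.
have comp u v b : u \in Q -> v \in Q -> b \in <[u]> -> b \in <[v]> -> b != 1 ->
    u \in <[v]> \/ v \in <[u]>.
  move=> Qu Qv bu bv ntb.
  apply: (@p_elts_comparable _ G p u v y b chG _ _ yG _ _ _ _ p'y nty _ ntb).
  - exact: QG.
  - exact: QG.
  - exact: comm_y.
  - exact: comm_y.
  - exact: mem_p_elt pQ Qu.
  - exact: mem_p_elt pQ Qv.
  by rewrite inE bu.
have sub_pow u : u \in Q -> u ^+ p != 1 -> X \subset <[u]>.
  move=> Qu up; have cux := comm_x u Qu.
  have uxp : (u * x) ^+ p = u ^+ p by rewrite expgMn // -ox expg_order mulg1.
  have sXu g : g \in Q -> g ^+ p = u ^+ p -> x \in <[g]> -> X \subset <[u]>.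
    move=> Qg gp xg; apply: subset_trans (cycleX u p); rewrite -gp.
    apply: (@prime_sub_cyclic_pgroup _ p <[g]>); rewrite ?cycle_cyclic ?cycleX //.
    - exact: mem_p_elt pQ Qg.
    - by rewrite defX cycle_subG.
    - by rewrite gp cycle_eq1.
  have [] := comp u (u * x) (u ^+ p) Qu (groupM Qu Qx) (mem_cycle _ _) _ up.
  - by rewrite -uxp mem_cycle.
  - move=> u_ux; apply: (sXu (u * x)); rewrite ?groupM //.
    by rewrite -(groupMl _ u_ux) cycle_id.
  by move=> ux_u; apply: (sXu u) => //; rewrite -(groupMl _ (cycle_id u)).
move=> ncycQ expQ.
have [|p2 [u [Qu up nsQu out_u]]] := comparable_pgroup_cases prX pQ _ ncycQ expQ.
  move=> u v Qu Qv up vp; apply: (comp u v x) => //.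
    by rewrite -cycle_subG -defX sub_pow.
  by rewrite -cycle_subG -defX sub_pow.
have sXu := sub_pow u Qu up; rewrite p2 in up out_u *.
have [w Qw nuw] := subsetPn nsQu; split=> //; split.
- move=> t /centerP[Qt cQt] t2; have [ut | nut] := boolP (t \in <[u]>).
    have [-> | ntt] := eqVneq t 1; first exact: group1.
    suffices -> : X = <[t]>%G by apply: cycle_id.
    apply: (prime_card_cyclic_eq (cycle_cyclic u)); rewrite ?cycle_subG //.
    by rewrite -orderE -/p p2 (nt_prime_order _ t2 ntt).
  (* Outside <u> all elements are involutions, t and u t among them; as t is
     central, u would be an involution too. *)
  have nuut : u * t \notin <[u]> by rewrite groupMl // cycle_id.
  case/eqP: up; rewrite -[RHS](out_u (u * t) (groupM Qu Qt) nuut).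
  by rewrite expgMn ?t2 ?mulg1 //; apply/commute_sym/cQt.
- exists w => //; split; first exact: out_u.
  by apply: contra nuw; apply: subsetP.
move=> H invH; have Hout g : g \in Q -> g \notin <[u]> -> g \in H.
  by move=> Qg nug; apply: invH => //; apply: out_u.
apply/subsetP=> g Qg; have [ug | /Hout-> //] := boolP (g \in <[u]>).
(* Both w and g w lie outside <u>, so they are involutions. *)
have nugw : g * w \notin <[u]> by rewrite groupMl.
by rewrite -(groupMr _ (Hout w Qw nuw)); apply: Hout nugw; apply: groupM.
Qed.

(** * Solvable groups with dihedral-like centralisers *)

Lemma norm_card2 (gT : finGroupType) (X : {group gT}) :
  #|X| = 2 -> 'N(X) \subset 'C(X).
Proof.
move=> oX; have prX : prime #|X| by rewrite oX.
have [x defX] := cyclicP (prime_cyclic prX).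
have ox : #[x] = 2 by rewrite orderE -defX.
rewrite defX cent_cycle; apply/subsetP=> g /normP nxg.
have : x ^ g \in <[x]> by rewrite -cycle_subG cycleJ nxg.
rewrite cycle2g // => /set2P[xg | xg]; last exact/cent1P/commute_sym/commgP/conjg_fixP.
by have := ox; rewrite -(orderJ x g) xg order1.
Qed.

(** The Fitting subgroup of C / O_p'(C) is nontrivial and nilpotent, and its
    p'-part lies in O_p' of that quotient, which is trivial. *)
Lemma solvable_pcore_quotient (gT : finGroupType) (p : nat) (C : {group gT}) :
  prime p -> solvable C -> p %| #|C| -> 'O_p(C / 'O_p^'(C)) != 1.
Proof.
move=> prp solC p_dv; apply/eqP=> Op1; set Cb := C / _ in Op1.
have solCb : solvable Cb by apply: quotient_sol.
have p'F : p^'.-group 'F(Cb).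
  have := card_Hall (nilpotent_pcore_Hall p (Fitting_nil Cb)).
  rewrite /= p_core_Fitting Op1 cards1 => /esym/eqP.
  by rewrite partn_eq1 ?cardG_gt0.
have : 'F(Cb) == 1.
  by rewrite -subG1 -(trivg_pcore_quotient p^' C) pcore_max ?Fitting_normal.
rewrite trivg_Fitting // -subG1 quotient_sub1 ?gFnorm // => sCK.
have p'C := pgroupS sCK (pcore_pgroup _ _).
by rewrite /pgroup p'natE // p_dv in p'C.
Qed.

(** Each core is a full Sylow 2-subgroup of C, because its normaliser
    centralises its central involution; by Sylow's theorem all involutions of C
    are then conjugate. The normal subgroup L = O_2',2(C) has an involution x,
    so it has them all and contains the Sylow subgroup Q whose centre contains
    x. By the Frattini argument C = N_C(Q) Q K with K = O_2'(C), where N_C(Q) and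
    Q centralise x. Hence an involution w of Q is conjugate to x under K; then
    x w lies in both K and Q, and w = x. *)
Lemma no_dihedral_like_cores (gT : finGroupType) (C : {group gT})
    (core : {group gT} -> {group gT}) :
    solvable C -> 2 %| #|C| ->
    (forall X : {group gT}, X \subset C -> #|X| = 2 ->
       [/\ core X <| 'C_C(X), 2.-Sylow('C_C(X)) (core X) & dihedral_like X (core X)]) ->
  False.
Proof.
move=> solC evenC coreP.
have X_core (X : {group gT}) : X \subset C -> #|X| = 2 -> X \subset 'Z(core X).
  move=> sXC oX; have [nsQ sylQ _] := coreP X sXC oX.
  have cXQ : core X \subset 'C(X) by apply: subset_trans (normal_sub nsQ) (subsetIr _ _).
  rewrite subsetI centsC cXQ andbT (sub_normal_Hall sylQ nsQ) /pgroup ?oX ?pnat_id //.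
  by rewrite subsetI sXC -abelianE cyclic_abelian ?prime_cyclic ?oX.
have pow2 (X : {group gT}) t : #|X| = 2 -> t \in X -> t ^+ 2 = 1.
  by move=> oX Xt; rewrite -oX expg_cardG.
(* Conjugate cores have conjugate central involutions. *)
have coreJ (X X' : {group gT}) g : X \subset C -> #|X| = 2 -> X' \subset C -> #|X'| = 2 ->
    core X' :=: core X :^ g -> X' :=: X :^ g.
  move=> sXC oX sXC' oX' eqQ; have [_ _ [Zinv _ _]] := coreP X' sXC' oX'.
  apply/esym/eqP; rewrite eqEcard cardJg oX oX' leqnn andbT; apply/subsetP=> t Xgt.
  apply: Zinv; last by apply: (pow2 (X :^ g)%G); rewrite ?cardJg.
  by rewrite /center eqQ centJ -conjIg; apply: subsetP Xgt; rewrite conjSg X_core.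
have sylC (X : {group gT}) : X \subset C -> #|X| = 2 -> 2.-Sylow(C) (core X).
  move=> sXC oX; have [nsQ sylQ _] := coreP X sXC oX.
  have sQC : core X \subset C by apply: subset_trans (normal_sub nsQ) (subsetIl _ _).
  have [S sylS sQS] := Sylow_superset sQC (pHall_pgroup sylQ).
  have pS := pHall_pgroup sylS.
  rewrite -(nilpotent_sub_norm (pgroup_nil pS) sQS) //.
  rewrite (sub_normal_Hall sylQ nsQ); first exact: pgroupS (subsetIl _ _) pS.
  rewrite subsetI subIset ?(pHall_sub sylS) //=.
  apply: subset_trans (norm_card2 oX); apply/subsetP=> g /setIP[_ /normP nQg].
  by apply/normP/esym; apply: coreJ.
have conjC (X X' : {group gT}) : X \subset C -> #|X| = 2 -> X' \subset C -> #|X'| = 2 ->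
    exists2 g, g \in C & X' :=: X :^ g.
  move=> sXC oX sXC' oX'.
  have [g Cg defQ] := Sylow_trans (sylC X sXC oX) (sylC X' sXC' oX').
  by exists g => //; apply: coreJ.
pose K := 'O_2^'(C)%G; pose L := (coset K @*^-1 'O_2(C / K))%G.
have nsKC : K <| C := pcore_normal _ _.
have [_ nKC] := andP nsKC.
have nsLC : L <| C by rewrite -(quotientGK nsKC) cosetpre_normal pcore_normal.
have [sLC _] := andP nsLC.
have LK : L / K = 'O_2(C / K) by rewrite cosetpreK.
have evenL : 2 %| #|L|.
  apply: dvdn_trans (dvdn_quotient L K); rewrite LK.
  have ntO2 := solvable_pcore_quotient (isT : prime 2) solC evenC.
  by have [] := pgroup_pdiv (pcore_pgroup 2 (C / K)) ntO2.
have [x Lx ox] := Cauchy (isT : prime 2) evenL.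
pose X := <[x]>%G; have oX : #|X| = 2 by [].
have sXL : X \subset L by rewrite cycle_subG.
have sXC := subset_trans sXL sLC.
have [nsQ _ [_ [w Qw [w2 nXw]] genQ]] := coreP X sXC oX.
set Q := core X in nsQ Qw genQ.
have sylQ : 2.-Sylow(C) Q := sylC X sXC oX.
have sQC := pHall_sub sylQ.
have conjX t : t \in C -> t != 1 -> t ^+ 2 = 1 -> exists2 g, g \in C & <[t]> = X :^ g.
  move=> Ct ntt t2; have ot : #[t] = 2 := nt_prime_order (isT : prime 2) t2 ntt.
  by apply: (conjC X <[t]>%G sXC oX _ ot); rewrite cycle_subG.
have sQL : Q \subset L.
  apply: genQ => t Qt t2; have [-> | ntt] := eqVneq t 1; first exact: group1.
  have [g Cg eqt] := conjX t (subsetP sQC t Qt) ntt t2.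
  by rewrite -cycle_subG eqt -(normP (subsetP (normal_norm nsLC) g Cg)) conjSg.
have sylQL := pHall_subl sQL sLC sylQ.
have defL : Q * K = L.
  have nKL := subset_trans sLC nKC; have nKQ := subset_trans sQL nKL.
  have : Q / K = L / K.
    apply: pHall_id (quotient_pHall nKQ sylQL) _; rewrite /= LK; apply: pcore_pgroup.
  have sKL : K \subset L by apply: sub_cosetpre.
  move=> eqQL; rewrite normC //; apply/eqP; rewrite eqEsubset mul_subG //=.
  by rewrite -quotientSK // eqQL.
(* An element conjugating X to <w> is decomposed along C = N_C(Q) Q K. *)
have fratC : L * 'N_C(Q) = C := Frattini_arg nsLC sylQL.
have ntw : w != 1 by apply: contraNneq nXw => ->; apply: group1.
have [g Cg eqw] := conjX w (subsetP sQC w Qw) ntw w2.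
have := groupVr Cg; rewrite -fratC => /mulsgP[l n Ll /setIP[Cn Nn] def_g].
have := groupVr Ll; rewrite -defL => /mulsgP[s k Qs Kk def_l].
have XN : X :^ n^-1 = X by apply/esym/coreJ; rewrite ?(normP (groupVr Nn)).
have cXQ : Q \subset 'C(X) by apply: subset_trans (normal_sub nsQ) (subsetIr _ _).
have XQ : X :^ s = X by apply/normP; apply: (subsetP (cent_sub _)); apply: subsetP Qs.
have eqwk : <[w]> = X :^ k.
  by rewrite eqw -(invgK g) def_g invMg conjsgM XN def_l conjsgM XQ.
have Xwk : w \in X :^ k by rewrite -eqwk cycle_id.
have [x' Xx' def_w] := imsetP Xwk.
have Qx' : x' \in Q by apply: subsetP Xx'; apply: subset_trans (X_core X sXC oX) (center_sub _).
case/negP: nXw; suffices -> : w = x' by [].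
have coKQ : coprime #|K| #|Q|.
  by rewrite coprime_sym (pnat_coprime (pHall_pgroup sylQ) (pcore_pgroup _ _)).
have Kxw : x'^-1 * w \in K.
  rewrite def_w -/(commg x' k) commgEr groupM // memJ_norm ?groupV //.
  by apply: subsetP (subsetP sQC x' Qx').
have : x'^-1 * w \in K :&: Q by rewrite inE Kxw groupM ?groupV.
by rewrite (coprime_TIg coKQ) => /set1P/(canRL (mulKVg _)); rewrite mulg1.
Qed.

(** * A vertex all of whose leaves are dihedral-like *)

Lemma linkedJ (gT : finGroupType) (G A B : {group gT}) g :
  g \in G -> linked G (A :^ g)%G (B :^ g)%G = linked G A B.
Proof.
move=> Gg; rewrite /linked /= !cardJg centJ conjSg.
by rewrite -{1 2}(conjGid Gg) !conjSg.
Qed.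

Lemma leafJ (gT : finGroupType) (G X Y : {group gT}) g :
  g \in 'C_G(Y) -> leaf G (X :^ g)%G Y -> leaf G X Y.
Proof.
case/setIP=> Gg cYg /leafP[lXgY leafXg].
have YgE : (Y :^ g)%G = Y.
  by apply/val_inj/normP; apply: subsetP cYg; apply: cent_sub.
apply/leafP; split=> [|W lXW]; first by rewrite -(linkedJ _ _ Gg) YgE.
have := leafXg (W :^ g)%G; rewrite linkedJ // => /(_ lXW)/(congr1 val)/=.
by rewrite -{1}YgE => /conjsg_inj eqWY; apply/val_inj.
Qed.

(** The product s s^t is fixed by t, hence trivial: a nontrivial one would generate
    R, and t would centralise R. *)
Lemma prime_order_invert (gT : finGroupType) (R : {group gT}) t :
    prime #|R| -> t \in 'N(R) -> t ^+ 2 = 1 -> t \notin 'C(R) ->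
  forall s, s \in R -> s ^ t = s^-1.
Proof.
move=> prR nRt t2 ncRt s Rs; have Rst : s ^ t \in R by rewrite memJ_norm.
have abR : abelian R by rewrite cyclic_abelian ?prime_cyclic.
have tt : t * t = 1 by [].
have fix_t : (s * s ^ t) ^ t = s * s ^ t.
  by rewrite conjMg -conjgM tt conjg1; apply: (centsP abR).
suffices /eqP z1 : s * s ^ t == 1 by apply/esym/eqP; rewrite eq_invg_mul z1.
apply: contraR ncRt => ntz; have Rz : s * s ^ t \in R by rewrite groupM.
have sRz : R \subset <[s * s ^ t]>.
  apply: (@prime_sub_cyclic_pgroup _ #|R| R) => //; rewrite ?prime_cyclic ?cycle_subG //.
    by rewrite /pgroup pnat_id.
  by rewrite cycle_eq1.
apply: (subsetP (centS sRz)); rewrite cent_cycle; apply/cent1P/commute_sym.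
exact/commgP/conjg_fixP.
Qed.

(** The hypothesis on R0 singles out the only neighbour of Y that may fail to be
    a leaf. It cannot fail, by the action of C_G(Y) on R0; then every neighbour
    of Y has order 2, Burnside's theorem makes C_G(Y) solvable, and
    [no_dihedral_like_cores] applies. *)
Lemma dihedral_like_leaves_absurd (gT : finGroupType) (G Y X R0 : {group gT}) :
    power_chordal G -> leaf G X Y ->
    (forall W, linked G Y W -> W != R0 -> leaf G W Y) ->
    (forall W, leaf G W Y -> #|W| = 2 /\ dihedral_like W (leaf_core G W Y)) ->
  False.
Proof.
move=> chG leafX leafY badY; have [oX [ZX [w Qw [w2 nXw]] _]] := badY X leafX.
have [lXY _] := leafP _ _ _ leafX.
have [[sXG sYG] prX prY neqXY cXY] := linkedP _ _ _ lXY.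
have [_ sylQ] := leaf_structure chG leafX.
have nsQ := leaf_core_normal G X Y; have sXQ := leaf_sub_core leafX.
set Q := leaf_core G X Y in sylQ nsQ sXQ ZX Qw.
have sQM := normal_sub nsQ; have sQC := subset_trans sQM (subsetIl _ _).
have cXQ : Q \subset 'C(X) := subset_trans sQM (subsetIr _ _).
have linkY (W : {group gT}) : W \subset 'C_G(Y) -> prime #|W| -> #|W| <> #|Y| -> linked G Y W.
  rewrite subsetI => /andP[sWG cWY] prW neqWY; rewrite linked_sym.
  by apply/linkedP.
have all_leaf W : linked G Y W -> leaf G W Y.
  move=> lYW; apply: contraT => nleafW.
  have defR0 : W = R0 by apply: contraNeq nleafW; apply: leafY.
  move: lYW nleafW; rewrite {W}defR0 => lYR nleafR.
  have [_ _ prR neqYR cYR] := linkedP _ _ _ lYR.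
  have sRC : R0 \subset 'C_G(Y).
    by have [[_ sRG] _ _ _ _] := linkedP _ _ _ lYR; rewrite subsetI sRG centsC.
  (* Conjugation by C_G(Y) permutes the neighbours of Y and preserves leaves. *)
  have nRC : 'C_G(Y) \subset 'N(R0).
    apply/subsetP=> g Cg; apply/normP; apply: contraNeq nleafR => neqR.
    apply: (leafJ Cg); apply: leafY; last by apply: contra neqR => /eqP{2}<-.
    have [Gg cYg] := setIP Cg.
    have YgE : (Y :^ g)%G = Y by apply/val_inj/normP; apply: subsetP cYg; apply: cent_sub.
    by rewrite -{1}YgE linkedJ.
  have sXC : X \subset 'C_G(Y) := subset_trans sXQ sQC.
  have [oR | neqR2] := eqVneq #|R0| 2.
    have cRC : 'C_G(Y) \subset 'C(R0) := subset_trans nRC (norm_card2 oR).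
    have sRQ : R0 \subset Q.
      rewrite (sub_normal_Hall sylQ nsQ) /pgroup ?oR ?oX ?pnat_id //.
      by rewrite subsetI sRC centsC (subset_trans sXC).
    case/negP: nleafR; rewrite (_ : R0 = X) //; apply/val_inj/eqP.
    rewrite /= eqEcard oX oR leqnn andbT; apply/subsetP=> t Rt; apply: ZX.
      rewrite inE (subsetP sRQ) //=; apply: subsetP Rt.
      by rewrite centsC (subset_trans sQC).
    by rewrite -oR expg_cardG.
  have inv_R t : t \in 'C_G(Y) -> t != 1 -> t ^+ 2 = 1 -> forall s, s \in R0 -> s ^ t = s^-1.
    move=> Ct ntt t2; have ot : #[t] = 2 := nt_prime_order (isT : prime 2) t2 ntt.
    apply: prime_order_invert => //; first exact: (subsetP nRC).
    have lYt : linked G Y <[t]>%G.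
      by apply: linkY; rewrite ?cycle_subG -?orderE ?ot // -oX.
    have [_ leaf_t] : linked G <[t]> Y /\ forall W, linked G <[t]> W -> W = Y.
      by apply/leafP/leafY => //; apply: contraNneq neqR2 => <-; rewrite -orderE ot.
    apply/negP=> cRt; case: neqYR; rewrite -(leaf_t R0) //.
    have [[_ sRG] _ _ _ _] := linkedP _ _ _ lYR.
    apply/linkedP; rewrite !cycle_subG -?orderE ot; split=> //; last by move/esym/eqP; apply/negP.
    by case/setIP: Ct.
  have [x defX] := cyclicP (prime_cyclic prX).
  have ntx : x != 1 by rewrite -order_gt1 orderE -defX prime_gt1.
  have x2 : x ^+ 2 = 1 by rewrite -oX defX expg_order.
  have Qx : x \in Q by rewrite -cycle_subG -defX.
  have ntw : w != 1 by apply: contraNneq nXw => ->; apply: group1.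
  have cxw : commute x w.
    by apply/commute_sym/cent1P; rewrite -cent_cycle -defX (subsetP cXQ).
  have ntxw : x * w != 1.
    apply: contraNneq nXw => /(canRL (mulKg _)); rewrite mulg1 => ->.
    by rewrite groupV defX cycle_id.
  have xw2 : (x * w) ^+ 2 = 1 by rewrite expgMn // x2 w2 mulg1.
  have sQC_ := subsetP sQC.
  (* x, w and x w all invert R0. *)
  have R1 s : s \in R0 -> s ^+ 2 = 1.
    move=> Rs; have := inv_R (x * w) (sQC_ _ (groupM Qx Qw)) ntxw xw2 s Rs.
    rewrite conjgM (inv_R x) ?sQC_ // conjVg (inv_R w) ?sQC_ // invgK => def_s.
    by rewrite expgS {2}def_s mulgV.
  have [s Rs os] := Cauchy prR (dvdnn _).
  by case/negP: neqR2; rewrite -dvdn_prime2 // -os order_dvdn R1.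
have oW W : linked G Y W -> #|W| = 2 by move/all_leaf/badY=> [].
apply: (@no_dihedral_like_cores _ 'C_G(Y)%G (leaf_core G ^~ Y)).
- apply: Burnside_p_a_q_b; apply: (@uniq_leq_size _ _ [:: 2; #|Y|]) (primes_uniq _) _ => r.
  rewrite mem_primes !inE => /and3P[prr _ /(Cauchy prr)[z Cz oz]].
  have [-> | /eqP neqrY] := eqVneq r #|Y|; first by rewrite orbT.
  by rewrite -oz [#[z]]orderE (oW <[z]>%G) //; apply: linkY; rewrite ?cycle_subG -?orderE ?oz.
- by rewrite -oX cardSg // (subset_trans sXQ).
move=> W sWC eqW2; have lWY : leaf G W Y.
  by apply/all_leaf/linkY; rewrite ?eqW2 // -oX.
have [_ dihW] := badY W lWY; have [_ sylW] := leaf_structure chG lWY.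
by rewrite -eqW2; split=> //; apply: leaf_core_normal.
Qed.

(** * Components of the Gruenberg-Kegel graph *)

Lemma linked_gk_adj (gT : finGroupType) (G A B : {group gT}) (p q : gk_vertex G) :
  linked G A B -> ssval p = #|A| -> ssval q = #|B| -> gk_adj p q.
Proof.
case/linkedP=> [[sAG sBG] prA prB neqAB cAB] def_p def_q.
have [a defA] := cyclicP (prime_cyclic prA); have [b defB] := cyclicP (prime_cyclic prB).
apply/andP; split; first by apply/eqP=> eqpq; case: neqAB; rewrite -def_p -def_q eqpq.
apply/exists_inP; exists (a * b).
  by rewrite groupM // -cycle_subG -?defA -?defB.
rewrite def_p def_q orderM.
- by rewrite !orderE -defA -defB.
- by apply: (centsP cAB); rewrite ?defA ?defB cycle_id.
by rewrite !orderE -defA -defB prime_coprime // dvdn_prime2 //; apply/eqP.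
Qed.

Lemma gk_adj_linked (gT : finGroupType) (G : {group gT}) (p q : gk_vertex G) :
  gk_adj p q -> exists A B : {group gT}, linked G A B /\ ssval p = #|A|.
Proof.
case/andP=> neqpq /exists_inP[g Gg /eqP og].
have pr (r : gk_vertex G) : prime (ssval r).
  by have := ssvalP r; rewrite mem_primes; case/and3P.
exists <[g ^+ ssval q]>%G, <[g ^+ ssval p]>%G.
have oA : #[g ^+ ssval q] = ssval p.
  by rewrite orderXdiv og ?dvdn_mull // mulnK ?prime_gt0.
have oB : #[g ^+ ssval p] = ssval q.
  by rewrite orderXdiv og ?dvdn_mulr // mulKn ?prime_gt0.
split; last by rewrite -oA.
apply/linkedP; rewrite -!orderE oA oB; split=> //.
- by rewrite !cycle_subG !groupX.
- by move/val_inj/eqP; apply/negP.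
by rewrite cycle_subG /= cent_cycle; apply/cent1P/commuteX2.
Qed.

Lemma connect_linked_gk (gT : finGroupType) (G A B : {group gT}) (p : gk_vertex G) :
    connect (linked G) A B -> ssval p = #|A| ->
  exists2 q : gk_vertex G, ssval q = #|B| & connect (@gk_adj gT G) p q.
Proof.
case/connectP=> s; elim: s A p => [|D s IHs] A p /=.
  by move=> _ -> def_p; exists p.
case/andP=> lAD path_s defB def_p.
have [[_ sDG] _ prD _ _] := linkedP _ _ _ lAD.
have D_pr : #|D| \in primes #|G| by rewrite mem_primes prD cardG_gt0 cardSg.
pose r : gk_vertex G := SeqSub D_pr.
have [q def_q con_q] := IHs D r path_s defB (erefl _).
exists q => //; apply: connect_trans con_q; apply: connect1.
exact: linked_gk_adj lAD def_p _.
Qed.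

Theorem lemma3p19 (gT : finGroupType) (G : {group gT})
    (chG : power_chordal G)
    (C : {set gk_vertex G}) (compC : C \in gk_components G)
    (nonsingC : #|C| <> 1%N) :
  exists2 p : gk_vertex G, p \in C &
  exists x : gT, exists q : nat, exists Z P : {group gT},
    [/\ x \in G, #[x] = ssval p & prime q] /\
    [/\ q <> ssval p, 'C_G[x] = Z ><| P, cyclic Z, q.-group Z
      & (ssval p).-group P] /\
    (cyclic 'C_P(Z) \/ exponent 'C_P(Z) = ssval p).
Proof.
have [p0 _ defC] := imsetP compC.
have [p1 adj_p0] : exists p1, gk_adj p0 p1.
  apply/existsP; apply: contra_notT nonsingC => /existsPn no_p1; apply/eqP/cards1P.
  exists p0; rewrite defC; apply/setP=> q; rewrite !inE eq_sym.
  apply/idP/eqP => [|->]; last exact: connect0.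
  by case/connectP=> [[|r s] /=]; rewrite ?(negPf (no_p1 _)).
have [A [B [lAB def_p0]]] := gk_adj_linked adj_p0.
have [Y [X [R0 [conY lYX neqXR nearY]]]] :=
  acyclic_near_leaf (@linked_sym _ G) (@linked_irr _ G) (linked_acyclic chG) lAB.
have leafY W : linked G Y W -> W != R0 -> leaf G W Y.
  move=> lYW neqWR; apply/leafP; split; first by rewrite linked_sym.
  exact: nearY.
pose good W := cyclic (leaf_core G W Y) || (exponent (leaf_core G W Y) == #|W|).
have [/existsP[W /andP[leafW goodW]] | /existsPn badY] :=
    boolP [exists W, leaf G W Y && good W]; last first.
  case: (dihedral_like_leaves_absurd chG (leafY X lYX neqXR) leafY) => W leafW.
  have := badY W; rewrite leafW negb_or => /andP[ncyc nexp].
  exact: leaf_core_cases.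
have [lWY _] := leafP _ _ _ leafW.
have [[sWG sYG] prW prY neqWY _] := linkedP _ _ _ lWY.
have conW : connect (linked G) A W.
  by apply: connect_trans conY (connect1 _); rewrite linked_sym.
have [p def_p con_p] := connect_linked_gk conW def_p0.
have [x defW] := cyclicP (prime_cyclic prW).
have [[Z [P [defCW cycZ qZ pP defQ]]] _] := leaf_structure chG leafW.
exists p; first by rewrite defC inE.
exists x, #|Y|, Z, P; rewrite def_p -cent_cycle -defW defQ; split; last split.
- by split=> //; rewrite ?orderE -?defW // -cycle_subG -defW.
- by split=> //; move/esym.
by case/orP: goodW => [|/eqP]; [left | right].
Qed.
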